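(* For any $\tau\in\overline{\mathbb{R}}_+$ and $(a,k)\in\mathcal{T}$, define $$d^*_{(a,k)}(\tau):=\begin{cases}\theta_k^*\wedge\tau, & a>\tau,\\ \theta_k^*, & a=\tau\ge\xi_k,\\ +\infty, & a=\tau<\xi_k,\\ +\infty, & a<\tau,\end{cases}$$ and $$\Phi_{(a,k)}(\tau):=(a-d^*_{(a,k)}(\tau))_+-H[(X_k-d^*_{(a,k)}(\tau))_+]-(a-\tau)_+.$$ There is an optimal solution $\tau^*\in\overline{\mathbb{R}}_+$ maximizing the reinsurer's profit $$\int_{\mathcal{T}}\Phi_{(a,k)}(\tau)\,\mathbb{Q}(da\times dk)$$ over $\tau\in\overline{\mathbb{R}}_+$, and the optimal deductibles and optimal premiums, for $(a,k)\in\mathcal{T}$, for the problem $$\max_{M=\{v,d_{(a,k)}\}\in\mathcal{M}_1}\ \int_{\mathbb{R}_+\times K}\{(a-d_{(a,k)})_+-H[(X_k-d_{(a,k)})_+]-v(a)\}\,\mathbb{Q}(da\times dk)$$ are given by $d^*_{(a,k)}(\tau^* )$ and $$P^*_{(a,k)}=\begin{cases}\tau^*-\theta_k^*\wedge\tau^*, & a>\tau^*,\\ \tau^*-\theta_k^*, & a=\tau^*\ge\xi_k,\\ 0, & a=\tau^*<\xi_k,\\ 0, & a<\tau^*,\end{cases}$$ respectively.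
   Context: Setting. $\mathbb{R}_+=[0,\infty)$, $\overline{\mathbb{R}}_+=[0,\infty]$, $(x-\infty)_+=0$. $K$ is a Polish space with its Borel $\sigma$-algebra. For each $k\in K$, $X_k$ is a nonnegative random variable (loss) with distribution function $F_k$ that is strictly increasing and continuous on its support, with possibly a jump at $0$; $\overline{F}_k=1-F_k$. $\tilde{\mathcal{T}}\subset(0,1)\times K$ is a measurable set whose projection onto $K$ is all of $K$, with $\alpha<1-F_k(0)$ for all $(\alpha,k)\in\tilde{\mathcal{T}}$, and $\mathrm{VaR}_\alpha(X_k)=\overline{F}_k^{-1}(\alpha)$. The (injective) map $\iota(\alpha,k)=(\mathrm{VaR}_\alpha(X_k),k)$ from $\tilde{\mathcal{T}}$ to $\mathbb{R}_+\times K$ is assumed measurable; $\mathcal{T}:=\iota(\tilde{\mathcal{T}})$ is the (measurable) set of types $(a,k)$. $\tilde{\mathbb{Q}}$ is a probability measure on $\tilde{\mathcal{T}}$ and $\mathbb{Q}=\tilde{\mathbb{Q}}\circ\iota^{-1}$ is its image on $\mathbb{R}_+\times K$, so $\mathbb{Q}$ is concentrated on $\mathcal{T}$. $H:\mathcal{X}\to\mathbb{R}$ is a cost functional on a domain $\mathcal{X}$ of random variables containing all $X_k$ (and the transforms of them to which $H$ is applied); $H$ is monotone, convex, comonotonic additive, satisfies $H[X]\ge 0$ for nonnegative $X$ with $H[X]=0$ only if $X=0$ a.s., and $H[1]=1+\theta>1$. For $k\in K$, the function $B_{X_k}(d):=-d-H[(X_k-d)_+]$ is concave on $\mathbb{R}_+$;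 $\theta_k^*$ denotes the point where $B_{X_k}$ attains its maximum ($\theta_k^*=+\infty$ if $B_{X_k}$ is increasing on all of $\mathbb{R}_+$), and $\xi_k:=-B_{X_k}(\theta_k^* )=\theta_k^*+H[(X_k-\theta_k^* )_+]$. Menus. $\mathcal{V}$ is the collection of all increasing, convex, 1-Lipschitz functions on $\mathbb{R}_+$ that vanish at $0$. $\mathcal{M}_1$ is the collection of feasible stop-loss menus $M=\{v,d_{(a,k)}\}$, where $v\in\mathcal{V}$ (indirect utility) and $d_{(a,k)}\in\overline{\mathbb{R}}_+$, $(a,k)\in\mathbb{R}_+\times K$ (deductibles; the indemnity for type $(a,k)$ is $I_{(a,k)}(x)=(x-d_{(a,k)})_+$), such that for every $(a,k)\in\mathbb{R}_+\times K$, $$v(a')-v(a)\ge(a'-d_{(a,k)})_+-(a-d_{(a,k)})_+\quad\text{for any }a'\in\mathbb{R}_+.$$ The premium of the policy for type $(a,k)$ is $P_{(a,k)}=I_{(a,k)}(a)-v(a)$. Only menus for which the integrand of the objective is measurable and integrable are considered. Deductibles and premiums on $\mathcal{T}$ are ''optimal'' if a feasible menu having these deductibles and premiums at the types in $\mathcal{T}$ (with indirect utility $v(a)=(a-\tau^* )_+$) attains the maximum; types outside $\mathcal{T}$ have $\mathbb{Q}$-measure zero.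
   Formalization: Added assumptions: k ↦ H[(X_k−d)_+] is Borel for each finite d ≥ 0 (so the integrals are defined), and (a−ξ_k)_+ is Q-integrable on T; without the latter the profit can be unbounded in τ and no optimal τ* exists. *)

(* Defs.v *)
From HB Require Import structures.
From mathcomp Require Import all_boot all_order all_algebra.
From mathcomp Require Import all_classical all_reals all_analysis.

Set Implicit Arguments.
Unset Strict Implicit.
Unset Printing Implicit Defensive.

Import Order.TTheory GRing.Theory Num.Theory.
Import numFieldNormedType.Exports.

Local Open Scope classical_set_scope.
Local Open Scope ring_scope.

Definition polish_space (R : realType) (K : topologicalType) : Prop :=
  (exists2 A : set K, countable A & dense A) /\
  exists dist : K -> K -> R,
    [/\ (forall x y, dist x y = 0 <-> x = y),
        (forall x y, dist x y = dist y x),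
        (forall x y z, dist x z <= dist x y + dist y z),
        (forall x, nbhs x = filter_from [set e : R | 0 < e]
                              (fun e => [set y | dist x y < e])) &
        (forall u : nat -> K,
          (forall e : R, 0 < e -> exists N : nat, forall m n : nat,
             (N <= m)%N -> (N <= n)%N -> dist (u m) (u n) < e) ->
          exists l : K, u n @[n --> \oo] --> l)].

Definition borel (K : ptopologicalType) : measurableType (@open K).-sigma :=
  g_sigma_algebraType (@open K).

(* (x - d)_+ with the convention (x - oo)_+ = 0 *)
Definition stop_loss (R : realType) (d : \bar R) (x : R) : R :=
  fine (maxe (x%:E - d)%E 0%E).

Section RandomVariables.
Context {dO : measure_display} {Omega : measurableType dO} {R : realType}.
Variable P : probability Omega R.

Definition law_support (X : {RV P >-> R}) : set R :=
  [set x | forall e : R, 0 < e -> (0 < distribution P X (ball x e))%E].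

Definition loss_variable (X : {RV P >-> R}) : Prop :=
  [/\ {ae P, forall w, 0 <= X w},
      (forall x y, law_support X x -> law_support X y -> x < y ->
         (cdf X x < cdf X y)%E) &
      (forall x, law_support X x -> x != 0 -> {for x, continuous (cdf X)})].

(* The generalized inverse at alpha of the survival function of X. *)
Definition VaR (alpha : R) (X : {RV P >-> R}) : R :=
  inf [set x : R | 0 <= x /\ (ccdf X x <= alpha%:E)%E].

Definition comonotonic (X Y : Omega -> R) : Prop :=
  forall w w', 0 <= (X w - X w') * (Y w - Y w').

(* H is only meaningful on its domain dom. Sums need not stay in dom, so
   comonotonic additivity is required when the sum does. *)
Record cost_functional (dom : set (Omega -> R)) (H : (Omega -> R) -> R)
    (theta : R) : Prop := {
  dom_measurable : forall X, dom X -> measurable_fun setT X ;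
  dom_convex : forall X Y (t : R), dom X -> dom Y -> 0 <= t <= 1 ->
    dom (fun w => t * X w + (1 - t) * Y w) ;
  dom_one : dom (cst 1) ;
  cost_monotone : forall X Y, dom X -> dom Y ->
    {ae P, forall w, X w <= Y w} -> H X <= H Y ;
  cost_convex : forall X Y (t : R), dom X -> dom Y -> 0 <= t <= 1 ->
    H (fun w => t * X w + (1 - t) * Y w) <= t * H X + (1 - t) * H Y ;
  cost_comonotonic_additive : forall X Y, dom X -> dom Y ->
    dom (fun w => X w + Y w) -> comonotonic X Y ->
    H (fun w => X w + Y w) = H X + H Y ;
  cost_ge0 : forall X, dom X -> {ae P, forall w, 0 <= X w} -> 0 <= H X ;
  cost_eq0 : forall X, dom X -> {ae P, forall w, 0 <= X w} -> H X = 0 ->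
    {ae P, forall w, X w = 0} ;
  cost_one : H (cst 1) = 1 + theta ;
  loading_gt0 : 0 < theta
}.

End RandomVariables.

(* Only the values of the utility on [0, +oo[ and of the deductibles on
   [0, +oo[ x K matter. *)
Record menu (R : realType) (K : ptopologicalType) := Menu {
  utility : R -> R ;
  deductible : (R * borel K)%type -> \bar R
}.

Section Model.
Context {dO : measure_display} {Omega : measurableType dO} {R : realType}
  {P : probability Omega R} {K : ptopologicalType}.
Variables (X : K -> {RV P >-> R}) (H : (Omega -> R) -> R).

Local Notation types := (R * borel K)%type.

Definition iota_map (p : types) : types := (VaR p.1 (X p.2), p.2).

Definition ceded_cost (d : \bar R) (k : K) : R := H (stop_loss d \o X k).

(* The function B_{X_k}. *)
Definition Bfun (k : K) (d : R) : R := - d - ceded_cost d%:E k.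

(* s is a point of [0, +oo] where B_{X_k} attains its maximum on [0, +oo[;
   s = +oo stands for a B_{X_k} that increases on all of [0, +oo[. *)
Definition Bmax_point (k : K) (s : \bar R) : Prop :=
  match s with
  | r%:E => 0 <= r /\ forall d, 0 <= d -> Bfun k d <= Bfun k r
  | +oo%E => {in `[0, +oo[ &, {homo Bfun k : x y / x <= y}}
  | -oo%E => False
  end.

(* [profit d u (a, k)] is what the reinsurer earns from type (a, k) when its
   deductible is d and its indirect utility is u. *)
Definition profit (d : \bar R) (u : R) (t : types) : R :=
  stop_loss d t.1 - ceded_cost d t.2 - u.

Definition type_space : set types := [set t | 0 <= t.1].

Definition utilities (v : R -> R) : Prop :=
  [/\ {in `[0, +oo[ &, {homo v : x y / x <= y}},
      convex_function (`[0, +oo[%classic : set R) v,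
      1.-lipschitz_(`[0, +oo[%classic) (v : R^o -> R^o) &
      v 0 = 0].

Definition feasible (M : menu R K) : Prop :=
  utilities (utility M) /\
  forall t, type_space t ->
    (0 <= deductible M t)%E /\
    forall a' : R, 0 <= a' ->
      utility M a' - utility M t.1 >=
      stop_loss (deductible M t) a' - stop_loss (deductible M t) t.1.

Definition premium (M : menu R K) (t : types) : R :=
  stop_loss (deductible M t) t.1 - utility M t.1.

Definition menu_profit (M : menu R K) (t : types) : R :=
  profit (deductible M t) (utility M t.1) t.

Section Optimality.
Variable Q : probability types R.

Definition admissible (M : menu R K) : Prop :=
  feasible M /\ Q.-integrable type_space (EFin \o menu_profit M).

Definition optimal_menu (M : menu R K) : Prop :=
  admissible M /\
  forall M', admissible M' ->
    (\int[Q]_(t in type_space) (menu_profit M' t)%:E <=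
     \int[Q]_(t in type_space) (menu_profit M t)%:E)%E.

End Optimality.

Section Candidate.
(* [thetas k] is the maximum point of B_{X_k}. *)
Variable thetas : K -> \bar R.

Definition xi (k : K) : \bar R :=
  (thetas k + (ceded_cost (thetas k) k)%:E)%E.

Definition dstar (tau : \bar R) (t : types) : \bar R :=
  if (tau < t.1%:E)%E then mine (thetas t.2) tau
  else if t.1%:E == tau then
    (if (xi t.2 <= tau)%E then thetas t.2 else +oo%E)
  else +oo%E.

Definition Pstar (tau : \bar R) (t : types) : \bar R :=
  if (tau < t.1%:E)%E then (tau - mine (thetas t.2) tau)%E
  else if t.1%:E == tau then
    (if (xi t.2 <= tau)%E then (tau - thetas t.2)%E else 0%E)
  else 0%E.

Definition Phi (tau : \bar R) (t : types) : R :=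
  profit (dstar tau t) (stop_loss tau t.1) t.

Definition profit_maximizer (Q : probability types R) (T : set types)
    (tau : \bar R) : Prop :=
  (0 <= tau)%E /\
  forall tau', (0 <= tau')%E ->
    (\int[Q]_(t in T) (Phi tau' t)%:E <= \int[Q]_(t in T) (Phi tau t)%:E)%E.

End Candidate.

End Model.

(* Main.v *)
Require Import Defs.
From HB Require Import structures.
From mathcomp Require Import all_boot all_order all_algebra.
From mathcomp Require Import all_classical all_reals all_analysis.
From mathcomp Require Import measurable_realfun ring lra.

Set Implicit Arguments.
Unset Strict Implicit.
Unset Printing Implicit Defensive.

Import Order.TTheory GRing.Theory Num.Theory.
Import numFieldNormedType.Exports.

Local Open Scope classical_set_scope.
Local Open Scope ring_scope.

(* In a feasible menu every type a either has a deductible at least a, and then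
   comparison with type 0 forces v(a) = 0, or a smaller one, and then v has
   slope 1 on the right of a; hence v(a) = (a - tau)_+ for some tau in [0, oo].
   Given tau, the profit from a type (a, k) is at most Phi_(a,k)(tau): if
   a > tau the deductible is at most tau, so the profit is at most tau minus
   the minimum of d + H[(X_k - d)_+] over [0, tau], which by convexity is
   attained at the minimum of theta_k and tau. It remains to maximize over tau:
   Phi is upper semicontinuous in tau and dominated by the integrable function
   (a - xi_k)_+, so by the reverse Fatou lemma its integral attains its maximum
   on the compact set [0, oo]. *)

(** * Stop-loss functions *)

Section StopLoss.
Context {R : realType}.
Implicit Types (r x y e : R).

Lemma stop_loss_fin r x : stop_loss r%:E x = Num.max (x - r) 0.
Proof. by rewrite /stop_loss -EFinB -EFin_max. Qed.

Lemma stop_loss_pinfty x : stop_loss +oo%E x = 0.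
Proof. by rewrite /stop_loss addeNy maxNye. Qed.

Lemma stop_loss_ge0 (d : \bar R) x : (0 <= d)%E -> 0 <= stop_loss d x.
Proof.
case: d => [r| |] // _; last by rewrite stop_loss_pinfty.
by rewrite stop_loss_fin le_max lexx orbT.
Qed.

Lemma stop_loss_homo (d : \bar R) : (0 <= d)%E -> {homo stop_loss d : x y / x <= y}.
Proof.
case: d => [r| |] // _ x y xy; last by rewrite !stop_loss_pinfty.
rewrite !stop_loss_fin.
by case: (leP (x - r) 0) => ?; case: (leP (y - r) 0) => ?; lra.
Qed.

Lemma stop_loss_nincr r e x : r <= e -> stop_loss e%:E x <= stop_loss r%:E x.
Proof.
rewrite !stop_loss_fin => ?.
by case: (leP (x - r) 0) => ?; case: (leP (x - e) 0) => ?; lra.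
Qed.

Lemma stop_loss_le_shift r e x : 0 <= e ->
  stop_loss r%:E x <= stop_loss (r + e)%:E x + e.
Proof.
rewrite !stop_loss_fin => ?.
by case: (leP (x - r) 0) => ?; case: (leP (x - (r + e)) 0) => ?; lra.
Qed.

Lemma stop_loss_convex r e x (t : R) : 0 <= t <= 1 ->
  stop_loss (t * r + (1 - t) * e)%:E x <=
  t * stop_loss r%:E x + (1 - t) * stop_loss e%:E x.
Proof.
move=> t01; rewrite !stop_loss_fin ge_max; apply/andP; split; last first.
  by rewrite addr_ge0// mulr_ge0 ?le_max ?lexx ?orbT//; lra.
have -> : x - (t * r + (1 - t) * e) = t * (x - r) + (1 - t) * (x - e) by ring.
by rewrite lerD// ler_wpM2l ?le_max ?lexx//; lra.
Qed.

End StopLoss.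

(** * The ceded cost as a function of the deductible *)

Section CededCost.
Context {dO : measure_display} {Omega : measurableType dO} {R : realType}
  {P : probability Omega R} {K : ptopologicalType}.
Variables (X : K -> {RV P >-> R}).
Variables (dom : set (Omega -> R)) (H : (Omega -> R) -> R) (theta : R).
Hypothesis H_cost : cost_functional P dom H theta.
Hypothesis dom_stop_loss : forall k (d : \bar R), (0 <= d)%E ->
  dom (stop_loss d \o X k).

Local Notation S := (ceded_cost X H).

Let dom0 : dom (cst 0).
Proof.
(* The zero variable is the stop loss with infinite deductible, for an arbitrary index [point]. *)
have := @dom_stop_loss point +oo%E (leey _); congr dom.
by apply/funext => w /=; rewrite stop_loss_pinfty.
Qed.

Lemma cost_zero : H (cst 0) = 0.
Proof.
have e0 : (fun w : Omega => (cst 0 w + cst 0 w : R)) = cst 0.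
  by apply/funext => w /=; rewrite addr0.
have := @cost_comonotonic_additive _ _ _ _ _ _ _ H_cost _ _ dom0 dom0.
rewrite e0 => /(_ dom0) h.
have : comonotonic (cst 0 : Omega -> R) (cst 0) by move=> w w'; rewrite /= subrr mul0r.
by move/h; lra.
Qed.

Let dom_scale Y (t : R) : dom Y -> 0 <= t <= 1 -> dom (fun w => t * Y w).
Proof.
move=> dY t01; have := @dom_convex _ _ _ _ _ _ _ H_cost _ _ _ dY dom0 t01.
by congr dom; apply/funext => w /=; rewrite mulr0 addr0.
Qed.

(** [Y / 2] is comonotonic with itself and the sum [Y] lies in [dom], so comonotonic additivity
    applies. *)
Lemma cost_half Y : dom Y -> H Y = 2 * H (fun w => 2^-1 * Y w).
Proof.
move=> dY.
have dh : dom (fun w => 2^-1 * Y w) by apply: dom_scale => //; lra.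
have eY : (fun w => 2^-1 * Y w + 2^-1 * Y w) = Y by apply/funext => w; lra.
have := @cost_comonotonic_additive _ _ _ _ _ _ _ H_cost _ _ dh dh.
rewrite eY => /(_ dY) ->; first by lra.
by move=> w w'; rewrite -expr2 sqr_ge0.
Qed.

Lemma ceded_cost_ge0 k (d : \bar R) : (0 <= d)%E -> 0 <= S d k.
Proof.
move=> d0; apply: (cost_ge0 H_cost); first exact: dom_stop_loss.
by apply: aeW => w; exact: stop_loss_ge0.
Qed.

Lemma ceded_cost_pinfty k : S +oo%E k = 0.
Proof.
rewrite -cost_zero; congr H; apply/funext => w /=.
by rewrite stop_loss_pinfty.
Qed.

Lemma ceded_cost_nincr k (d e : R) : 0 <= d -> d <= e -> S e%:E k <= S d%:E k.
Proof.
move=> d0 de; have e0 := le_trans d0 de.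
apply: (cost_monotone H_cost); [exact: dom_stop_loss..|].
by apply: aeW => w /=; exact: stop_loss_nincr.
Qed.

(** Pointwise convexity in the deductible passes through the monotone convex [H]. *)
Lemma ceded_cost_convex k (d e t : R) : 0 <= d -> 0 <= e -> 0 <= t <= 1 ->
  S (t * d + (1 - t) * e)%:E k <= t * S d%:E k + (1 - t) * S e%:E k.
Proof.
move=> d0 e0 t01; have [t0 t1] := andP t01.
have dd : dom (stop_loss d%:E \o X k) by exact: dom_stop_loss.
have de : dom (stop_loss e%:E \o X k) by exact: dom_stop_loss.
apply: le_trans (cost_convex H_cost dd de t01).
apply: (cost_monotone H_cost).
- by apply: dom_stop_loss; rewrite lee_fin addr_ge0// mulr_ge0// subr_ge0.
- exact: (dom_convex H_cost).
by apply: aeW => w /=; exact: stop_loss_convex.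
Qed.

(* Sums need not stay in [dom], whence the rescaling by 1/2: [dom] is convex
   and [H] is homogeneous for the factor 1/2. *)
Lemma ceded_cost_le_shift k (d e : R) : 0 <= d -> 0 <= e <= 1 ->
  S d%:E k <= S (d + e)%:E k + e * (1 + theta).
Proof.
move=> d0 e01; have [e0 _] := andP e01.
have dd : dom (stop_loss d%:E \o X k) by exact: dom_stop_loss.
have de : dom (stop_loss (d + e)%:E \o X k).
  by apply: dom_stop_loss; rewrite lee_fin addr_ge0.
(* The constant [e] is a convex combination of 1 and 0, whose costs are known. *)
have he : H (fun=> e) <= e * (1 + theta).
  have eE : (fun=> e) = (fun w : Omega => e * cst 1 w + (1 - e) * cst 0 w).
    by apply/funext => w /=; rewrite mulr1 mulr0 addr0.
  rewrite eE; apply: le_trans (cost_convex H_cost (dom_one H_cost) dom0 e01) _.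
  have -> : H (cst 0) = 0 by exact: cost_zero.
  by rewrite (cost_one H_cost) mulr0 addr0.
have dom_e : dom (fun=> e).
  have := dom_scale (dom_one H_cost) e01.
  by congr dom; apply/funext => w /=; rewrite mulr1.
have h01 : 0 <= (2^-1 : R) <= 1 by rewrite invr_ge0 ler0n invf_le1 ?ler1n.
(* After halving, the right-hand side of the pointwise bound is a convex combination of members of
   [dom]; [cost_half] undoes the halving on the left. *)
have : H (fun w => 2^-1 * (stop_loss d%:E \o X k) w) <=
    H (fun w => 2^-1 * (stop_loss (d + e)%:E \o X k) w + (1 - 2^-1) * e).
  apply: (cost_monotone H_cost).
  - exact: dom_scale.
  - exact: (dom_convex H_cost de dom_e h01).
  apply: aeW => w /=.
  by have := @stop_loss_le_shift _ d e (X k w) e0; lra.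
have := cost_convex H_cost de dom_e h01.
have := cost_half dd.
by rewrite /ceded_cost /=; move: he; lra.
Qed.

End CededCost.

(** * Minimal and capped total costs, and a closed form of [Phi] *)

Section TotalCost.
Context {dO : measure_display} {Omega : measurableType dO} {R : realType}
  {P : probability Omega R} {K : ptopologicalType}.
Variables (X : K -> {RV P >-> R}).
Variables (dom : set (Omega -> R)) (H : (Omega -> R) -> R) (theta : R).
Hypothesis H_cost : cost_functional P dom H theta.
Hypothesis dom_stop_loss : forall k (d : \bar R), (0 <= d)%E ->
  dom (stop_loss d \o X k).
Variable thetas : K -> \bar R.
Hypothesis thetasP : forall k, Bmax_point X H k (thetas k).

Local Notation S := (ceded_cost X H).

(** This is [- Bfun k d], so a maximum point of [Bfun] is a minimum point here. *)
Definition total_cost (d : R) (k : K) : R := d + S d%:E k.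

Definition rtheta (k : K) : R := fine (thetas k).

Definition min_cost (k : K) : R := total_cost (rtheta k) k.

(* The minimum of [total_cost] over the deductibles at most [tau]. *)
Definition capped_cost (tau : R) (k : K) : R :=
  total_cost (Num.min (rtheta k) tau) k.

(* As [B d <= - d], B cannot increase on the whole half-line. *)
Lemma Bmax_point_finite k : thetas k = (rtheta k)%:E /\ 0 <= rtheta k.
Proof.
rewrite /rtheta; have := thetasP k; case: (thetas k) => [r [r0 _]| |] //= Bincr.
have S00 : 0 <= S 0%:E k by exact: (ceded_cost_ge0 H_cost dom_stop_loss).
have d0 : 0 <= S 0%:E k + 1 by rewrite addr_ge0.
(* B is at most [- S 0 - 1] at this point, strictly below its value [- S 0] at 0. *)
have := Bincr 0 (S 0%:E k + 1).
rewrite !in_itv/= !andbT lexx d0 => /(_ isT isT isT); rewrite /Bfun.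
have : 0 <= S (S 0%:E k + 1)%:E k by exact: (ceded_cost_ge0 H_cost dom_stop_loss).
by move=> *; exfalso; lra.
Qed.

Lemma thetasE k : thetas k = (rtheta k)%:E.
Proof. by have [] := Bmax_point_finite k. Qed.

Lemma rtheta_ge0 k : 0 <= rtheta k.
Proof. by have [] := Bmax_point_finite k. Qed.

Lemma xiE k : xi X H thetas k = (min_cost k)%:E.
Proof. by rewrite /xi thetasE -EFinD. Qed.

Lemma min_cost_le d k : 0 <= d -> min_cost k <= total_cost d k.
Proof.
move=> d0; have := thetasP k; rewrite thetasE => -[_ /(_ d d0)].
by rewrite /Bfun /min_cost /total_cost; lra.
Qed.

(** Ensures that the deductible chosen when [t.1 = tau] and [xi <= tau] is at most [tau], as
    feasibility requires. *)
Lemma rtheta_le_min_cost k : rtheta k <= min_cost k.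
Proof.
rewrite /min_cost /total_cost lerDl.
by rewrite (ceded_cost_ge0 H_cost dom_stop_loss)// lee_fin rtheta_ge0.
Qed.

Lemma min_cost_le_capped tau k : 0 <= tau -> min_cost k <= capped_cost tau k.
Proof. by move=> t0; rewrite min_cost_le// le_min rtheta_ge0. Qed.

(** If the minimum point exceeds [tau], then [tau] lies between [d] and it; by convexity the cost at
    [tau] is at most the larger of the two end values, which is the one at [d]. *)
Lemma capped_cost_le tau d k : 0 <= d <= tau -> capped_cost tau k <= total_cost d k.
Proof.
move=> /andP[d0 dt]; rewrite /capped_cost.
have [th|th] := leP (rtheta k) tau; first exact: min_cost_le.
have dth : 0 < rtheta k - d by rewrite subr_gt0 (le_lt_trans dt).
(* The weight of [d] when [tau] is written as a convex combination of [d] and [rtheta k]. *)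
pose t := (rtheta k - tau) / (rtheta k - d).
have t01 : 0 <= t <= 1.
  rewrite divr_ge0 ?subr_ge0 ?(ltW th) ?(ltW (le_lt_trans dt th))//=.
  by rewrite ler_pdivrMr// mul1r lerB.
have tauE : tau = t * d + (1 - t) * rtheta k by rewrite /t; field; rewrite gt_eqF.
have := ceded_cost_convex H_cost dom_stop_loss k d0 (rtheta_ge0 k) t01.
have := min_cost_le k d0; rewrite -tauE /min_cost /total_cost => h1 h2.
have := ler_wpM2l (_ : 0 <= 1 - t) h1.
by move=> /(_ ltac:(lra)); move: tauE h2; lra.
Qed.

(** The profit from types above [tau] is [- S tau] up to the minimum point and [tau - min_cost k]
    beyond it, nondecreasing on both ranges. This controls sequences approaching a limit from the
    left. *)
Lemma capped_cost_homo s tau k : 0 <= s -> s <= tau ->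
  s - capped_cost s k <= tau - capped_cost tau k.
Proof.
move=> s0 st; have [th|th] := leP (rtheta k) s.
  by rewrite /capped_cost !min_l// ?(le_trans th)// lerB.
have t0 := le_trans s0 st.
have [th'|th'] := leP (rtheta k) tau.
  have -> : capped_cost s k = s + S s%:E k by rewrite /capped_cost min_r// ltW.
  have -> : capped_cost tau k = rtheta k + S (rtheta k)%:E k.
    by rewrite /capped_cost min_l.
  have := ceded_cost_nincr H_cost dom_stop_loss k s0 (ltW th).
  by lra.
have -> : capped_cost s k = s + S s%:E k by rewrite /capped_cost min_r// ltW.
have -> : capped_cost tau k = tau + S tau%:E k by rewrite /capped_cost min_r// ltW.
have := ceded_cost_nincr H_cost dom_stop_loss k s0 st.
by lra.
Qed.

(** Controls approach from the right: the growth rate is at most [1 + theta] before the minimum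
    point and 1 after it, and [2 + theta] is a crude bound for a step crossing it. *)
Lemma capped_cost_shift tau e k : 0 <= tau -> 0 <= e <= 1 ->
  tau + e - capped_cost (tau + e) k <= tau - capped_cost tau k + e * (2 + theta).
Proof.
move=> t0 /andP[e0 e1]; have eth : 0 <= e * theta.
  by rewrite mulr_ge0// ltW// (loading_gt0 H_cost).
have [th|th] := leP (rtheta k) tau.
  rewrite /capped_cost !min_l//; last by rewrite (le_trans th)// lerDl.
  by rewrite mulrDr; lra.
have -> : capped_cost tau k = tau + S tau%:E k by rewrite /capped_cost min_r// ltW.
rewrite /capped_cost /total_cost; set d := Num.min _ _.
have td : tau <= d by rewrite /d le_min (ltW th) lerDl.
have de : d <= tau + e by rewrite /d ge_min lexx orbT.
have := @ceded_cost_le_shift _ _ _ _ _ _ _ _ _ H_cost dom_stop_loss k tau (d - tau) t0.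
rewrite [tau + (d - tau)]addrC subrK => /(_ ltac:(lra)) h.
have : (d - tau) * (1 + theta) <= e * (1 + theta).
  by rewrite ler_wpM2r//; [have := loading_gt0 H_cost|]; lra.
by lra.
Qed.

(** Above [tau] both stop losses are linear and [t.1] cancels. At [t.1 = tau] the test on [xi]
    selects the better of the deductibles [thetas] and [+oo], whence the maximum with 0. *)
Lemma PhiE tau t : 0 <= tau -> 0 <= t.1 -> Phi X H thetas tau%:E t =
  if tau < t.1 then tau - capped_cost tau t.2
  else if t.1 == tau then Num.max (t.1 - min_cost t.2) 0 else 0.
Proof.
case: t => a k /= t0 a0; rewrite /Phi /profit /dstar /= lte_fin xiE thetasE.
rewrite -EFin_min lee_fin eqe stop_loss_fin.
have [ta|] := ltP tau a.
  rewrite stop_loss_fin /capped_cost /total_cost.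
  have : Num.min (rtheta k) tau <= tau by rewrite ge_min lexx orbT.
  set d := Num.min _ _ => dt.
  by rewrite !max_l; lra.
move=> at_; rewrite [Num.max (a - tau) 0]max_r ?subr_le0// subr0.
have [->|_] := eqVneq a tau; last first.
  by rewrite stop_loss_pinfty (ceded_cost_pinfty H_cost dom_stop_loss) subrr.
have [xt|xt] := leP (min_cost k) tau.
  have := rtheta_le_min_cost k; rewrite stop_loss_fin => th.
  rewrite !max_l ?subr_ge0//; last by rewrite (le_trans th).
  by rewrite /min_cost /total_cost; lra.
rewrite stop_loss_pinfty (ceded_cost_pinfty H_cost dom_stop_loss) subrr max_r//.
by rewrite subr_le0 ltW.
Qed.

Lemma Phi_pinfty t : Phi X H thetas +oo%E t = 0.
Proof.
rewrite /Phi /profit /dstar /= !stop_loss_pinfty.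
by rewrite (ceded_cost_pinfty H_cost dom_stop_loss) !subr0.
Qed.

(** Provides a dominating function independent of [tau], attained at [tau = t.1]. *)
Lemma Phi_le_envelope tau t : (0 <= tau)%E -> 0 <= t.1 ->
  Phi X H thetas tau t <= Num.max (t.1 - min_cost t.2) 0.
Proof.
case: tau => [r| |] // r0 a0; last by rewrite Phi_pinfty le_max lexx orbT.
rewrite PhiE//; case: ifPn => [ra|_].
  rewrite le_max lerB ?(ltW ra)//; exact: min_cost_le_capped.
by case: ifPn => //; rewrite le_max lexx orbT.
Qed.

End TotalCost.

(** * Measurability of [Phi] *)

Section MeasurableProfit.
Context {dO : measure_display} {Omega : measurableType dO} {R : realType}
  {P : probability Omega R} {K : ptopologicalType}.
Variables (X : K -> {RV P >-> R}).
Variables (dom : set (Omega -> R)) (H : (Omega -> R) -> R) (theta : R).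
Hypothesis H_cost : cost_functional P dom H theta.
Hypothesis dom_stop_loss : forall k (d : \bar R), (0 <= d)%E ->
  dom (stop_loss d \o X k).
Variable thetas : K -> \bar R.
Hypothesis thetasP : forall k, Bmax_point X H k (thetas k).
Hypothesis cost_measurable : forall d : R, 0 <= d ->
  measurable_fun [set: borel K] (ceded_cost X H d%:E).

(* The argmin [thetas] need not be measurable, but the minimum is an infimum
   over rational deductibles, as the ceded cost is nonincreasing. *)
Lemma measurable_cost_inf (p : R -> R) (d : K -> R) :
  (forall x, 0 <= p x) ->
  (forall x k, total_cost X H (d k) k <= total_cost X H (p x) k) ->
  (forall k, 0 <= d k) ->
  (forall x k, d k <= x -> d k <= p x <= x) ->
  measurable_fun [set: borel K] (fun k : borel K => total_cost X H (d k) k).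
Proof.
move=> p0 dmin d0 pd mD.
apply: (measurability _ (RGenInftyO.measurableE R)) => //.
move=> _ [_ [c ->] <-]; rewrite setTI.
have -> : (fun k : borel K => total_cost X H (d k) k) @^-1` `]-oo, c[ =
    \bigcup_(q : rat) ((fun k : borel K => total_cost X H (p (ratr q)) k) @^-1` `]-oo, c[).
  apply/seteqP; split => k /=; last first.
    by move=> [q _] /=; rewrite !in_itv/=; apply: le_lt_trans.
  rewrite in_itv/= => dc.
  (* Raising the deductible from [d k] by less than the gap to [c] keeps the total cost below [c],
     since only its linear term can grow. *)
  have /rat_in_itvoo[q] : d k < d k + (c - total_cost X H (d k) k).
    by rewrite ltrDl subr_gt0.
  rewrite in_itv/= => /andP[/ltW dq qc]; exists q => //=; rewrite in_itv/=.
  have /andP[dp pq] := pd _ k dq.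
  have := ceded_cost_nincr H_cost dom_stop_loss k (d0 k) dp.
  by move: dc qc; rewrite /total_cost; lra.
apply: bigcupT_measurable_rat => q; rewrite -[X in measurable X]setTI.
apply: measurable_funD => //; exact: cost_measurable.
Qed.

Lemma measurable_min_cost :
  measurable_fun [set: borel K] (min_cost X H thetas : borel K -> R).
Proof.
have theta0 := rtheta_ge0 H_cost dom_stop_loss thetasP.
apply: (@measurable_cost_inf (fun x => Num.max x 0)) => //.
- by move=> x; rewrite le_max lexx orbT.
- move=> x k; apply: (min_cost_le H_cost dom_stop_loss thetasP).
  by rewrite le_max lexx orbT.
by move=> x k kx; rewrite max_l ?kx ?lexx// (le_trans _ kx).
Qed.

Lemma measurable_capped_cost tau : 0 <= tau ->
  measurable_fun [set: borel K] (capped_cost X H thetas tau : borel K -> R).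
Proof.
move=> t0; have theta0 := rtheta_ge0 H_cost dom_stop_loss thetasP.
(* Rationals are clamped to [0, tau], the range over which the capped cost is minimal. *)
apply: (@measurable_cost_inf (fun x => Num.min (Num.max x 0) tau)) => //.
- by move=> x; rewrite le_min le_max lexx orbT.
- move=> x k; apply: (capped_cost_le H_cost dom_stop_loss thetasP).
  by rewrite le_min le_max lexx orbT t0 ge_min lexx orbT.
- by move=> k; rewrite le_min theta0.
move=> x k kx; have x0 : 0 <= x by rewrite (le_trans _ kx)// le_min theta0.
by rewrite (max_l x0) le_min kx ge_min lexx orbT /= ge_min lexx.
Qed.

Lemma measurable_type_space : measurable (@type_space R K).
Proof.
have -> : @type_space R K = setT `&` fst @^-1` `[0, +oo[%classic.
  by apply/seteqP; split => t /=; rewrite /type_space/= in_itv/= andbT//; case.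
by apply: measurable_fst => //; exact: measurable_itv.
Qed.

(** The closed form involves [thetas] only through [min_cost] and [capped_cost], both measurable. *)
Lemma measurable_Phi tau : (0 <= tau)%E ->
  measurable_fun (@type_space R K) (Phi X H thetas tau).
Proof.
move=> t0.
have mmin : measurable_fun [set: R * borel K] (fun t => min_cost X H thetas t.2).
  exact: measurableT_comp measurable_min_cost measurable_snd.
have mT : measurable (@type_space R K).
  exact: measurable_type_space.
case: tau t0 => [r r0| _|//]; last first.
  apply: (eq_measurable_fun (fun=> 0 : R)) => // t _.
  by rewrite (Phi_pinfty H_cost dom_stop_loss).
have mcap : measurable_fun [set: R * borel K] (fun t => capped_cost X H thetas r t.2).
  exact: measurableT_comp (measurable_capped_cost r0) measurable_snd.
apply: (eq_measurable_fun (fun t : R * borel K =>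
    if r < t.1 then r - capped_cost X H thetas r t.2
    else if t.1 == r then Num.max (t.1 - min_cost X H thetas t.2) 0 else 0)).
  by move=> t /set_mem t1; rewrite (PhiE H_cost dom_stop_loss thetasP).
apply: measurable_funTS.
apply: measurable_fun_ifT.
- exact: measurable_fun_ltr.
- exact: measurable_funB.
apply: measurable_fun_ifT.
- exact: measurable_fun_eqr.
- by apply: measurable_maxr => //; exact: measurable_funB.
- by [].
Qed.

End MeasurableProfit.

(** * Limits and compactness in the extended reals *)

Section ExtendedReals.
Context {R : realType}.
Implicit Types (u : nat -> \bar R) (c : \bar R).
Local Open Scope ereal_scope.

Lemma le_limn_einf u c : (\forall n \near \oo, c <= u n) -> c <= limn_einf u.
Proof.
move=> cu; rewrite /limn_einf leeNr /limn_esup limf_esupE.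
apply: le_trans (ereal_inf_lbound _) _; first by exists [set n | c <= u n] => //; exact: cu.
by apply: ge_ereal_sup => _ [n /= cn <-]; rewrite leeN2.
Qed.

Lemma limn_einf_le u c : (\forall n \near \oo, u n <= c) -> limn_einf u <= c.
Proof.
move=> uc; rewrite limn_einf_lim; apply: lime_le; first exact: is_cvg_einfs.
apply: filterS uc => n; apply: le_trans; apply: ereal_inf_lbound.
by exists n => /=.
Qed.

(** Distances in the extended reals are those of the images under [contract] in [-1, 1], so a
    convergent subsequence of the images can be pulled back by [expand]. *)
Lemma ereal_bolzano_weierstrass u :
  exists2 f : nat -> nat, increasing_seq f & exists l : \bar R, u (f n) @[n --> \oo] --> l.
Proof.
have bu : bounded_fun (fun n => contract (u n)).
  exists 1%R; split; [exact: num_real|] => M M1 n _ /=.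
  exact: le_trans (contract_le1 _) (ltW M1).
have [f fincr /cvg_ex[/= l fl]] := bolzano_weierstrass bu.
exists f => //; exists (expand l : \bar R).
have l1 : (`|l| <= 1)%R.
  rewrite ler_norml; apply/andP; split.
    apply: (cvgr_to_ge fl); apply: nearW => n /=.
    by have := contract_le1 (u (f n)); rewrite ler_norml => /andP[].
  apply: (cvgr_to_le fl); apply: nearW => n /=.
  by have := contract_le1 (u (f n)); rewrite ler_norml => /andP[].
apply/cvg_ballP => e e0; move/cvg_ballP : fl => /(_ e e0).
by apply: filterS => n; rewrite /ball /= /ereal_ball expandK.
Qed.

Lemma cvge_near_lt u l c : u n @[n --> \oo] --> l -> l < c -> \forall n \near \oo, u n < c.
Proof.
move=> ul lc; have /ul // : nbhs l [set y | y < c].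
by apply: open_nbhs_nbhs; split => //; exact: open_ereal_lt_ereal.
Qed.

Lemma cvge_near_gt u l c : u n @[n --> \oo] --> l -> c < l -> \forall n \near \oo, c < u n.
Proof.
move=> ul lc; have /ul // : nbhs l [set y | c < y].
by apply: open_nbhs_nbhs; split => //; exact: open_ereal_gt_ereal.
Qed.

End ExtendedReals.

(** * Existence of a maximizer of a parametrized integral *)

Section IntegralMaximizer.
Context {d : measure_display} {T : measurableType d} {R : realType}
  (mu : measure T R) (D : set T).
Hypothesis mD : measurable D.
Local Open Scope ereal_scope.

(** The positive part is dominated by that of [g]; an infinite integral of the negative part would
    make the whole integral [-oo]. *)
Lemma integrable_le_gtNy (f g : T -> \bar R) : measurable_fun D f ->
  mu.-integrable D g -> (forall x, D x -> f x <= g x) ->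
  -oo < \int[mu]_(x in D) f x -> mu.-integrable D f.
Proof.
move=> mf ig fg; rewrite integralE => fNy.
have mfp := measurable_funepos mf; have mfn := measurable_funeneg mf.
have fp : \int[mu]_(x in D) f^\+ x < +oo.
  apply: le_lt_trans (integral_funepos_lt_pinfty mD ig).
  apply: ge0_le_integral => //.
  - exact/measurable_funepos/(measurable_int mu ig).
  - by move=> x Dx; rewrite !funeposE ge_max !le_max fg// lexx orbT.
have fn : \int[mu]_(x in D) f^\- x < +oo.
  rewrite ltey; apply/eqP => fnoo; move: fNy.
  by rewrite fnoo addeNy ltxx.
apply/integrableP; split => //.
rewrite -[X in \int[mu]_(x in D) X x]/(abse \o f) fune_abse.
by rewrite ge0_integralD//; exact: lte_add_pinfty.
Qed.

(* Reverse Fatou lemma along a maximizing sequence. *)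
Lemma exists_integral_maximizer (F : \bar R -> T -> R) (g : T -> R) :
  mu.-integrable D (EFin \o g) ->
  (forall tau, 0 <= tau -> measurable_fun D (F tau)) ->
  (forall tau x, 0 <= tau -> D x -> (F tau x <= g x)%R) ->
  (exists2 tau, 0 <= tau & -oo < \int[mu]_(x in D) (F tau x)%:E) ->
  (forall (u : nat -> \bar R) l, (forall n, 0 <= u n) -> 0 <= l ->
     u n @[n --> \oo] --> l -> forall x, D x -> forall e : R, (0 < e)%R ->
     \forall n \near \oo, (F (u n) x <= F l x + e)%R) ->
  exists2 tau, 0 <= tau & forall tau', 0 <= tau' ->
    \int[mu]_(x in D) (F tau' x)%:E <= \int[mu]_(x in D) (F tau x)%:E.
Proof.
move=> ig mF Fg [tau0 tau00 J0] usc.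
pose J tau := \int[mu]_(x in D) (F tau x)%:E.
have mFE tau : 0 <= tau -> measurable_fun D (fun x => (F tau x)%:E).
  by move=> t0; apply/measurable_EFinP; exact: mF.
have FgE tau x : 0 <= tau -> D x -> (F tau x)%:E <= (EFin \o g) x.
  by move=> t0 Dx; rewrite lee_fin Fg.
have iF tau : 0 <= tau -> -oo < J tau -> mu.-integrable D (fun x => (F tau x)%:E).
  move=> t0 Jt; apply: (integrable_le_gtNy (mFE _ t0) ig) => // x; exact: FgE.
set I := \int[mu]_(x in D) (g x)%:E.
have Ifin : I \is a fin_num by exact: integrable_fin_num.
have JI tau : 0 <= tau -> J tau <= I.
  move=> t0; have [->|JNy] := eqVneq (J tau) -oo; first exact: leNye.
  apply: le_integral => //; first by apply: iF => //; rewrite ltNye.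
  by move=> x /set_mem; exact: FgE.
pose s := ereal_sup (J @` [set tau | 0 <= tau]).
have sJ tau : 0 <= tau -> J tau <= s by move=> t0; apply: ereal_sup_ubound; exists tau.
have sfin : s \is a fin_num.
  rewrite fin_numElt (lt_le_trans J0 (sJ _ tau00))/=.
  apply: (@le_lt_trans _ _ I); last by rewrite ltey_eq Ifin.
  by apply: ge_ereal_sup => _ [tau t0 <-]; exact: JI.
(* A maximizing sequence; the limit [l] of a subsequence will be the maximizer. *)
have /choice[u u_] : forall n, exists tau, 0 <= tau /\ s - (n.+1%:R^-1)%:E < J tau.
  move=> n; have n0 : (0 < n.+1%:R^-1 :> R)%R by rewrite invr_gt0.
  by have [_ [tau t0 <-] h] := ub_ereal_sup_adherent n0 sfin; exists tau.
have [f fincr [l fl]] := ereal_bolzano_weierstrass u.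
have u0 n : 0 <= u (f n) by have [] := u_ (f n).
have l0 : 0 <= l.
  rewrite leNgt; apply/negP => /(cvge_near_lt fl)[N _ /(_ N (leqnn N))/=].
  by apply/negP; rewrite -leNgt.
exists l => // tau' t'0; apply: (le_trans (sJ _ t'0)).
have JuNy n : -oo < J (u (f n)).
  apply: lt_trans (u_ (f n)).2.
  by rewrite ltNye_eq fin_numB sfin.
(* The gaps to the envelope are nonnegative, so Fatou's lemma applies to them. *)
pose G n x := (g x - F (u (f n)) x)%:E.
pose Gl x := (g x - F l x)%:E.
have mG tau : 0 <= tau -> measurable_fun D (fun x => (g x - F tau x)%:E).
  move=> t0; apply/measurable_EFinP/measurable_funB; last exact: mF.
  exact/measurable_EFinP/(measurable_int mu ig).
have G0 tau x : 0 <= tau -> D x -> 0 <= (g x - F tau x)%:E.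
  by move=> t0 Dx; rewrite lee_fin subr_ge0 Fg.
have Gint n : \int[mu]_(x in D) G n x = I - J (u (f n)).
  by rewrite /G -integralB//; exact: iF.
have Gle : \int[mu]_(x in D) Gl x <= I - s.
  apply: (@le_trans _ _ (\int[mu]_(x in D) limn_einf (G^~ x))).
    apply: ge0_le_integral => //.
    - by move=> x Dx; exact: G0.
    - exact: mG.
    - apply: measurableT_comp => //; apply: measurable_fun_limn_esup => n.
      by apply: measurableT_comp => //; exact: mG.
    (* Upper semicontinuity of [F] bounds the gap at [l] by the lower limit of the gaps. *)
    move=> x Dx; apply/lee_addgt0Pr => e e0; rewrite -leeBlDr//.
    apply: le_limn_einf; apply: filterS (usc _ _ u0 l0 fl x Dx e e0) => n.
    by rewrite /Gl /G -EFinB lee_fin; lra.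
  apply: le_trans (fatou mu mD (f := G) _ _) _.
  - by move=> n; exact: mG.
  - by move=> n x Dx; exact: G0.
  apply/lee_addgt0Pr => e e0; apply: limn_einf_le.
  have /increasing_seqP fS := fincr.
  (* Passing to the subsequence only improves the error [1 / (n + 1)]. *)
  have fge n : (n <= f n)%N by elim: n => // n ih; exact: leq_ltn_trans ih (fS n).
  have [N _ NP] := near_infty_natSinv_lt (PosNum e0).
  exists N => // n /= Nn; rewrite Gint -[X in _ <= X]addeA; apply: leeD2l => //.
  have Jfin : J (u (f n)) \is a fin_num by exact/(integrable_fin_num mD)/iF.
  have nfn : ((f n).+1%:R^-1 <= n.+1%:R^-1 :> R)%R.
    by rewrite lef_pV2 ?posrE// ler_nat ltnS.
  have ne : (n.+1%:R^-1 < e)%R := NP n Nn.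
  have := (u_ (f n)).2.
  move: Jfin sfin; case: (J (u (f n))) => [j| |]//; case: (s) => [r| |]//= _ _.
  rewrite -?EFinB -?EFinN -?EFinD lte_fin lee_fin.
  move=> h; rewrite lerNl opprD opprK; apply: ltW (le_lt_trans _ h).
  by rewrite lerD2l lerN2 (le_trans nfn)// ltW.
(* The gap at [l] has integral at most the finite [I - s]; subtracting it from [g] shows that the
   integral of [F l] is at least [s]. *)
have iGl : mu.-integrable D Gl.
  apply/integrableP; split; first exact: mG.
  under eq_integral => x /set_mem Dx do rewrite gee0_abs ?G0//.
  apply: le_lt_trans Gle _.
  by rewrite ltey_eq fin_numB Ifin sfin.
have Glfin : \int[mu]_(x in D) Gl x \is a fin_num by exact: integrable_fin_num.
rewrite (_ : \int[mu]_(x in D) (F l x)%:E = I - \int[mu]_(x in D) Gl x); last first.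
  rewrite /I -integralB//; apply: eq_integral => x _.
  by rewrite /Gl -EFinB; congr EFin; lra.
by rewrite leeBrDl// -leeBrDr.
Qed.

End IntegralMaximizer.

(** * Upper semicontinuity of [Phi] and the candidate menu *)

Section Menus.
Context {dO : measure_display} {Omega : measurableType dO} {R : realType}
  {P : probability Omega R} {K : ptopologicalType}.
Variables (X : K -> {RV P >-> R}).
Variables (dom : set (Omega -> R)) (H : (Omega -> R) -> R) (theta : R).
Hypothesis H_cost : cost_functional P dom H theta.
Hypothesis dom_stop_loss : forall k (d : \bar R), (0 <= d)%E ->
  dom (stop_loss d \o X k).
Variable thetas : K -> \bar R.
Hypothesis thetasP : forall k, Bmax_point X H k (thetas k).

Lemma Phi_lt_tau (tau : \bar R) (t : R * borel K) : (0 <= tau)%E -> 0 <= t.1 ->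
  (t.1%:E < tau)%E -> Phi X H thetas tau t = 0.
Proof.
case: tau => [r r0 a0|_ _ _|//]; last exact: (Phi_pinfty H_cost dom_stop_loss).
rewrite lte_fin => ar; rewrite (PhiE H_cost dom_stop_loss thetasP)//.
by rewrite ltNge (ltW ar)/= lt_eqF.
Qed.

(** If [l < t.1], monotonicity handles the terms left of [l] and the rate bound those to its right.
    If [t.1 < l], both sides eventually have zero profit. If [t.1 = l], the value at [l] is the
    envelope, which dominates every [Phi]. *)
Lemma Phi_usc (u : nat -> \bar R) (l : \bar R) (t : R * borel K) (e : R) :
  (forall n, (0 <= u n)%E) -> (0 <= l)%E -> u n @[n --> \oo] --> l ->
  0 <= t.1 -> 0 < e ->
  \forall n \near \oo, Phi X H thetas (u n) t <= Phi X H thetas l t + e.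
Proof.
move=> u0 l0 ul a0 e0.
have [la|al|la] := ltgtP l t.1%:E.
- case: l l0 la ul => [r| |]// r0; rewrite lte_fin => ra ul.
  have th0 : 0 < 2 + theta by have := loading_gt0 H_cost; lra.
  have [d d0 [d1 de]] : exists2 d, 0 < d & d <= 1 /\ d * (2 + theta) <= e.
    (* [capped_cost_shift] allows steps up to 1, and its error must stay within [e]. *)
    exists (Num.min 1 (e / (2 + theta))); first by rewrite lt_min ltr01 divr_gt0.
    split; first by rewrite ge_min lexx.
    by rewrite -ler_pdivlMr// ge_min lexx orbT.
  have rd : (r%:E < (r + d)%:E)%E by rewrite lte_fin ltrDl.
  have ra' : (r%:E < t.1%:E)%E by rewrite lte_fin.
  apply: filterS2 (cvge_near_lt ul ra') (cvge_near_lt ul rd) => n.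
  case: (u n) (u0 n) => [s s0|//|//]; rewrite !lte_fin => sa sd.
  rewrite !(PhiE H_cost dom_stop_loss thetasP)// sa ra.
  have [sr|rs] := leP s r.
    have := capped_cost_homo H_cost dom_stop_loss thetas t.2 s0 sr.
    by move: e0; lra.
  have := @capped_cost_shift _ _ _ _ _ _ _ _ _ H_cost dom_stop_loss thetas r (s - r) t.2 r0.
  rewrite (addrC r) subrK => /(_ ltac:(lra)).
  have : (s - r) * (2 + theta) <= d * (2 + theta) by rewrite ler_wpM2r ?ltW//; lra.
  by move: de; lra.
- apply: filterS (cvge_near_gt ul al) => n an.
  by rewrite (Phi_lt_tau (u0 n) a0 an) (Phi_lt_tau l0 a0 al) add0r ltW.
- apply: nearW => n.
  have := Phi_le_envelope H_cost dom_stop_loss thetasP (u0 n) a0.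
  rewrite la in l0 *; rewrite (PhiE H_cost dom_stop_loss thetasP)// ltxx eqxx.
  by move=> /le_trans; apply; rewrite lerDl ltW.
Qed.

Lemma stop_loss_utilities (tau : \bar R) : (0 <= tau)%E -> utilities (stop_loss tau).
Proof.
move=> t0; split.
- by move=> x y _ _; exact: stop_loss_homo.
- move=> t x y _ _; rewrite !convRE /unstable.onem.
  case: tau t0 => [r r0|_|//]; last by rewrite !stop_loss_pinfty !mulr0 addr0.
  have t_ge0 : 0 <= t%:num by [].
  have onem_t : 0 <= 1 - t%:num by rewrite subr_ge0.
  rewrite !stop_loss_fin ge_max; apply/andP; split; last first.
    by rewrite addr_ge0// mulr_ge0 ?le_max ?lexx ?orbT.
  have -> : t%:num * x + (1 - t%:num) * y - r =
      t%:num * (x - r) + (1 - t%:num) * (y - r) by ring.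
  by rewrite lerD// ler_wpM2l ?le_max ?lexx.
- move=> [x y] [/= _ _]; rewrite mul1r.
  case: tau t0 => [r r0|_|//]; last by rewrite !stop_loss_pinfty subrr normr0.
  rewrite !stop_loss_fin ler_norml; have := ler_norm (x - y).
  have := ler_norm (y - x); rewrite distrC.
  by case: (leP (x - r) 0) => ?; case: (leP (y - r) 0) => ?; lra.
case: tau t0 => [r r0|_|//]; last by rewrite stop_loss_pinfty.
by rewrite stop_loss_fin sub0r max_r// oppr_le0.
Qed.

(** Two kinds of deductible occur. An infinite one, for types at most [tau], only needs a
    nonnegative utility. A finite [d <= tau], for types at least [tau], works because
    [(a' - d)_+ - (a' - tau)_+] never exceeds [tau - d]. *)
Lemma feasible_dstar (tau : \bar R) : (0 <= tau)%E ->
  feasible (@Menu R K (stop_loss tau) (dstar X H thetas tau)).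
Proof.
move=> t0; split; first exact: stop_loss_utilities.
move=> [a k] a0 /=; rewrite /dstar /=.
have th0 := rtheta_ge0 H_cost dom_stop_loss thetasP k.
have thE := thetasE H_cost dom_stop_loss thetasP k.
have xiE := xiE H_cost dom_stop_loss thetasP k.
have thxi := rtheta_le_min_cost H_cost dom_stop_loss thetasP k.
rewrite xiE thE.
have oo : (a%:E <= tau)%E -> (0 <= +oo :> \bar R)%E /\ forall a', 0 <= a' ->
    stop_loss +oo%E a' - stop_loss +oo%E a <= stop_loss tau a' - stop_loss tau a.
  move=> at_; split=> // a' a'0; rewrite !stop_loss_pinfty subrr.
  have -> : stop_loss tau a = 0.
    case: tau t0 at_ => [r r0|_ _|//]; last by rewrite stop_loss_pinfty.
    by rewrite lee_fin stop_loss_fin => ar; rewrite max_r// subr_le0.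
  by rewrite subr0 stop_loss_ge0.
have fin d : 0 <= d -> (d%:E <= tau)%E -> (tau <= a%:E)%E ->
    (0 <= d%:E)%E /\ forall a', 0 <= a' ->
    stop_loss d%:E a' - stop_loss d%:E a <= stop_loss tau a' - stop_loss tau a.
  case: tau t0 {oo} => [r r0|//|//] d0; rewrite !lee_fin => dr ra.
  split=> // a' a'0; rewrite !stop_loss_fin (max_l (_ : 0 <= a - d)); last lra.
  rewrite (max_l (_ : 0 <= a - r)); last lra.
  by case: (leP (a' - d) 0) => ?; case: (leP (a' - r) 0) => ?; lra.
case: ifPn => [ta|]; last first.
  rewrite -leNgt => at_; case: ifPn => [/eqP ate|_]; last exact: oo.
  case: ifPn => [xt|_]; last exact: oo.
  by apply: fin => //; rewrite ?ate// (le_trans _ xt)// lee_fin.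
case: tau t0 ta oo fin => [r r0|//|//] ra oo fin.
rewrite -EFin_min; apply: fin => //; last exact: ltW.
- by rewrite le_min th0.
- by rewrite lee_fin ge_min lexx orbT.
Qed.

Lemma premium_dstar (tau : \bar R) (t : R * borel K) : (0 <= tau)%E -> 0 <= t.1 ->
  (premium (@Menu R K (stop_loss tau) (dstar X H thetas tau)) t)%:E =
  Pstar X H thetas tau t.
Proof.
case: t => a k t0 /= a0; rewrite /premium /dstar /Pstar /=.
have thE := thetasE H_cost dom_stop_loss thetasP k.
have xiE := xiE H_cost dom_stop_loss thetasP k.
have thxi := rtheta_le_min_cost H_cost dom_stop_loss thetasP k.
rewrite xiE thE.
case: tau t0 => [r r0|_|//]; last by rewrite /= !stop_loss_pinfty subrr.
rewrite -EFin_min lte_fin lee_fin eqe -!EFinB.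
have [ra|] := ltP r a.
  have mr : Num.min (rtheta thetas k) r <= r by rewrite ge_min lexx orbT.
  by rewrite !stop_loss_fin !max_l; [congr EFin; lra|lra..].
move=> ar; have [->|_] := eqVneq a r; last first.
  by rewrite stop_loss_pinfty stop_loss_fin max_r ?subr_le0// subrr.
have [xr|rx] := leP (min_cost X H thetas k) r.
  by rewrite !stop_loss_fin max_l ?subr_ge0 ?(le_trans thxi)// subrr maxxx subr0.
by rewrite stop_loss_pinfty stop_loss_fin subrr maxxx subrr.
Qed.

(** * Structure of feasible menus and the profit bound *)

Section FeasibleMenu.
Variable M : menu R K.
Hypothesis M_feasible : feasible M.
Local Notation v := (utility M).

Lemma utility_increment a b : 0 <= a -> a <= b -> 0 <= v b - v a <= b - a.
Proof.
move=> a0 ab; have b0 := le_trans a0 ab.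
have [[v_incr _ v_lip _] _] := M_feasible.
apply/andP; split; first by rewrite subr_ge0 v_incr// in_itv/= andbT.
have := ler_norm (v b - v a); move=> /le_trans; apply.
rewrite -[leRHS]ger0_norm ?subr_ge0//.
have := v_lip (b, a); rewrite /= mul1r; apply.
by split; rewrite /= in_itv/= andbT.
Qed.

Lemma utility_ge0 a : 0 <= a -> 0 <= v a.
Proof.
move=> a0; have /andP[+ _] := utility_increment (lexx 0) a0.
by have [[_ _ _ ->] _] := M_feasible; rewrite subr0.
Qed.

(* A deductible at least [a] forces [v a = 0] (compare with type 0), while a
   smaller one forces slope 1 to the right of [a]. *)
Lemma utility_dichotomy a : 0 <= a ->
  v a = 0 \/ forall b, a <= b -> v b = v a + (b - a).
Proof.
move=> a0; have [[_ _ _ v0] /(_ (a, point) a0)[d0 Md]] := M_feasible.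
have va0 := utility_ge0 a0.
case: (deductible M (a, point)) d0 Md => [r r0 Md|_ Md|//]; last first.
  left; have := Md 0 (lexx _); rewrite v0 !stop_loss_pinfty/=.
  by move: va0; lra.
have [ar|ra] := leP a r.
  left; have := Md 0 (lexx _); rewrite v0 !stop_loss_fin/= !max_r; last 2 first.
  - by rewrite subr_le0.
  - by rewrite sub0r oppr_le0.
  by move: va0; lra.
right=> b ab; have := Md b (le_trans a0 ab).
rewrite !stop_loss_fin/= !max_l; last 2 first.
- by rewrite subr_ge0 ltW.
- by rewrite subr_ge0 (le_trans (ltW ra)).
by have /andP[] := utility_increment a0 ab; lra.
Qed.

(** [tau] is the supremum of the zeros of [v], or [+oo] if [v] vanishes on the half-line. Beyond
    [tau] no zero is left, so the dichotomy gives slope 1 there. *)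
Lemma feasible_utilityE :
  exists2 tau : \bar R, (0 <= tau)%E & forall a, 0 <= a -> v a = stop_loss tau a.
Proof.
have [[_ _ _ v0] _] := M_feasible.
have [[a0 [a00 va0]]|noa] := pselect (exists a, 0 <= a /\ v a <> 0); last first.
  exists +oo%E => // a a0; rewrite stop_loss_pinfty.
  by apply: contrapT => va; apply: noa; exists a.
pose A := [set a | 0 <= a /\ v a = 0]; pose tau := sup A.
have A0 : A 0 by [].
have Aub : has_ubound A.
  exists a0 => a [a_ge0 va]; rewrite leNgt; apply/negP => /ltW a0a.
  have /andP[+ _] := utility_increment a00 a0a.
  by have := utility_ge0 a00; rewrite va; move=> *; apply: va0; lra.
have Atau a : A a -> a <= tau by move=> Aa; exact: ub_le_sup.
have tau0 : 0 <= tau by exact: Atau.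
have vtau : v tau = 0.
  apply/eqP; rewrite eq_le utility_ge0// andbT.
  (* By the Lipschitz bound every zero of [v] is at most [tau - v tau], hence so is their
     supremum. *)
  suff : tau <= tau - v tau by lra.
  apply: ge_sup; first by exists 0.
  move=> a [a_ge0 va]; have /andP[_] := utility_increment a_ge0 (Atau _ (conj a_ge0 va)).
  by rewrite va; lra.
exists tau%:E => // a a_ge0; rewrite stop_loss_fin.
have [at_|ta] := leP a tau.
  rewrite max_r ?subr_le0//.
  have /andP[+ _] := utility_increment a_ge0 at_.
  by have := utility_ge0 a_ge0; rewrite vtau; lra.
rewrite max_l ?subr_ge0 ?ltW//.
have /andP[_] := utility_increment tau0 (ltW ta); rewrite vtau subr0 => vle.
have va_ge0 := utility_ge0 a_ge0.
have [|lt_va] := leP (a - tau) (v a); first by move=> ?; apply/eqP; rewrite eq_le vle.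
(* The midpoint of [tau] and [a - v a]: slope 1 from [b] on would give [v a >= a - b > v a]. *)
exfalso; pose b := (tau + a - v a) / 2.
have tb : tau < b by rewrite /b; lra.
have ba : b <= a by rewrite /b; lra.
have b0 : 0 <= b by rewrite (le_trans tau0)// ltW.
have [vb|/(_ a ba)] := utility_dichotomy b0.
  by have := Atau b (conj b0 vb); rewrite leNgt tb.
by have := utility_ge0 b0; rewrite /b; lra.
Qed.

(** The argument splits on whether the indemnity at [a] vanishes. If so, the profit is at most 0 and
    [a > tau] is excluded. Otherwise [a < tau] is excluded, and the minimality of the capped or of
    the uncapped cost gives the bound. *)
Lemma menu_profit_le_Phi : exists2 tau : \bar R, (0 <= tau)%E &
  forall t, @type_space R K t -> menu_profit X H M t <= Phi X H thetas tau t.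
Proof.
have [tau t0 vE] := feasible_utilityE; exists tau => // -[a k] a0.
have [_ /(_ (a, k) a0)[/=]] := M_feasible.
rewrite /menu_profit /profit /type_space /= in a0 *.
move: (deductible M (a, k)) => d d0 Md.
have S0 := ceded_cost_ge0 H_cost dom_stop_loss k d0.
have va0 := utility_ge0 a0.
have [sl0|slN0] := eqVneq (stop_loss d a) 0.
  rewrite sl0; apply: (@le_trans _ _ (- v a)); first by move: S0; lra.
  have [la|al] := ltP tau a%:E; last first.
    apply: (@le_trans _ _ 0); first by rewrite oppr_le0.
    move: al; rewrite le_eqVlt => /orP[/eqP <-|al]; last by rewrite Phi_lt_tau.
    by rewrite (PhiE H_cost dom_stop_loss thetasP)//= ltxx eqxx le_max lexx orbT.
  (* Comparison with type 0 would force [v a <= 0], whereas [v a = a - r > 0]. *)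
  exfalso; case: tau t0 la vE => [r r0|//|//]; rewrite lte_fin => ra vE.
  have := Md 0 (lexx _); rewrite sl0 !vE// !stop_loss_fin.
  have := stop_loss_ge0 0 d0; have ar0 : 0 <= a - r by rewrite subr_ge0 ltW.
  have r0' : 0 - r <= 0 by rewrite sub0r oppr_le0.
  rewrite (max_l ar0) (max_r r0').
  by move: ra; lra.
case: d d0 Md S0 slN0 => [d d0 Md S0|_ _ _|//]; last by rewrite stop_loss_pinfty eqxx.
have [ad|da _] := leP a d.
  by rewrite stop_loss_fin max_r ?subr_le0// eqxx.
have slE b : a <= b -> stop_loss d%:E b = b - d.
  by move=> ab; rewrite stop_loss_fin max_l// subr_ge0 (le_trans (ltW da)).
rewrite slE//; have [al|la|la] := ltgtP a%:E tau.
(* On [[a, b]] the utility is flat while the indemnity has slope 1, against feasibility. *)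
- exfalso; have [b ab bt] : exists2 b, a < b & (b%:E <= tau)%E.
    case: tau t0 al {vE} => [r r0|_ _|//]; first by rewrite lte_fin; exists r.
    by exists (a + 1); rewrite ?ltrDl ?leey.
  have v_eq0 c : 0 <= c -> (c%:E <= tau)%E -> v c = 0.
    case: tau {al bt t0} vE => [r|vE c0 _|//]; last by rewrite vE// stop_loss_pinfty.
    by move=> vE c0 cr; rewrite vE// stop_loss_fin max_r// subr_le0 -lee_fin.
  have b0 := le_trans a0 (ltW ab).
  have := Md b b0; rewrite (slE b (ltW ab)) (slE a (lexx a)).
  by rewrite (v_eq0 b b0 bt) (v_eq0 a a0 (ltW al)); move: ab; lra.
- case: tau t0 la vE => [r r0|//|//]; rewrite lte_fin => ra vE.
  rewrite (PhiE H_cost dom_stop_loss thetasP)//= ra.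
  have ar0 : 0 <= a - r by rewrite subr_ge0 ltW.
  rewrite vE// stop_loss_fin (max_l ar0).
  (* Comparison with type 0 yields [d <= r]. *)
  have := Md 0 (lexx _); rewrite (slE a (lexx a)) !vE// !stop_loss_fin.
  rewrite (max_l ar0) !max_r ?sub0r ?oppr_le0// => dr.
  have d0r : 0 <= d <= r by apply/andP; split => //; move: dr; lra.
  have := capped_cost_le H_cost dom_stop_loss thetasP k d0r.
  by rewrite /total_cost; lra.
rewrite -la (PhiE H_cost dom_stop_loss thetasP)//= ltxx eqxx le_max.
have := min_cost_le H_cost dom_stop_loss thetasP k d0.
by rewrite /total_cost => ?; apply/orP; left; move: va0; lra.
Qed.

End FeasibleMenu.
End Menus.

(** * Existence of an optimal [tau] and optimality of the candidate menu *)

Theorem theorem5p3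
  (dO : measure_display) (Omega : measurableType dO) (R : realType)
  (P : probability Omega R) (K : ptopologicalType)
  (X : K -> {RV P >-> R})
  (dom : set (Omega -> R)) (H : (Omega -> R) -> R) (theta : R)
  (thetas : K -> \bar R)
  (Tt : set (R * borel K)%type)
  (Qt Q : probability (R * borel K)%type R)
  (T := iota_map X @` Tt)
  (K_polish : polish_space R K)
  (X_loss : forall k, loss_variable (X k))
  (H_cost : cost_functional P dom H theta)
  (dom_X : forall k, dom (X k))
  (dom_stop_loss : forall k (d : \bar R), (0 <= d)%E ->
     dom (stop_loss d \o X k))
  (thetasP : forall k, Bmax_point X H k (thetas k))
  (Tt_measurable : measurable Tt)
  (Tt_sub : forall p, Tt p -> 0 < p.1 < 1)
  (Tt_proj : snd @` Tt = setT)
  (Tt_atom : forall p, Tt p -> (p.1%:E < 1 - cdf (X p.2) 0)%E)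
  (iota_measurable : measurable_fun Tt (iota_map X))
  (T_measurable : measurable T)
  (Qt_Tt : Qt Tt = 1%E)
  (QE : forall A, measurable A -> Q A = Qt (Tt `&` iota_map X @^-1` A))
  (cost_measurable : forall d : R, 0 <= d ->
     measurable_fun [set: borel K] (ceded_cost X H d%:E))
  (envelope_integrable : Q.-integrable T
     (fun t => maxe (t.1%:E - xi X H thetas t.2)%E 0%E)) :
  (exists tau : \bar R, profit_maximizer X H thetas Q T tau) /\
  forall tau : \bar R, profit_maximizer X H thetas Q T tau ->
    exists M : menu R K,
      [/\ optimal_menu X H Q M,
          forall a : R, 0 <= a -> utility M a = stop_loss tau a &
          forall t, T t ->
            deductible M t = dstar X H thetas tau t /\
            (premium M t)%:E = Pstar X H thetas tau t].
Proof.
have TsubE : T `<=` @type_space R K.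
  move=> _ [p Ttp <-]; rewrite /type_space /= /VaR.
  (* The infimum of the empty set is 0 by default, so nonnegativity holds there too. *)
  have [->|/set0P A0] := eqVneq [set x | 0 <= x /\ (ccdf (X p.2) x <= p.1%:E)%E] set0.
    by rewrite inf0.
  by apply: lb_le_inf => // x [].
have mTS : measurable (@type_space R K) by exact: measurable_type_space.
(* A [Q]-null set, so integrals over the type space reduce to integrals over [T]. *)
set N := @type_space R K `\` T.
have mN : measurable N by exact: measurableD.
have TN : @type_space R K `\` N = T by rewrite /N setDD setIidr.
have QT : Q T = 1%E.
  rewrite QE// (_ : _ `&` _ = Tt)//; apply/seteqP; split => [p []//|p Ttp].
  by split => //; exists p.
have QN : Q N = 0%E.
  apply/eqP; rewrite eq_le measure_ge0 andbT.
  have <- : Q (~` T) = 0%E by rewrite probability_setC// QT subee.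
  by apply: le_measure; rewrite ?inE//; [exact: measurableC|move=> ? []].
pose g (t : R * borel K) := Num.max (t.1 - min_cost X H thetas t.2) 0.
have ig : Q.-integrable T (EFin \o g).
  rewrite (_ : EFin \o g = fun t => maxe (t.1%:E - xi X H thetas t.2)%E 0%E)//.
  apply/funext => t /=.
  by rewrite (xiE H_cost dom_stop_loss thetasP) -EFinB -EFin_max.
have mPhiTS tau : (0 <= tau)%E -> measurable_fun (@type_space R K) (Phi X H thetas tau).
  exact: (measurable_Phi H_cost dom_stop_loss thetasP cost_measurable).
have mPhi tau : (0 <= tau)%E -> measurable_fun T (Phi X H thetas tau).
  by move=> t0; apply: measurable_funS (mPhiTS _ t0).
have Phig tau t : (0 <= tau)%E -> T t -> Phi X H thetas tau t <= g t.
  move=> t0 Tt_; apply: (Phi_le_envelope H_cost dom_stop_loss thetasP) => //.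
  exact: TsubE.
(* The choice [tau = +oo] earns 0, which keeps the supremum, and the integral at any maximizer,
   above [-oo]. *)
have J0 : (\int[Q]_(t in T) (Phi X H thetas +oo t)%:E = 0)%E.
  by apply: integral0_eq => t _; rewrite (Phi_pinfty H_cost dom_stop_loss).
split.
  have [| |tau t0 taumax] := exists_integral_maximizer T_measurable ig mPhi Phig.
  - by exists +oo%E => //; rewrite J0.
  - move=> u l u0 l0 ul t /TsubE t1 e e0.
    exact: (Phi_usc H_cost dom_stop_loss thetasP).
  by exists tau.
move=> tau [t0 taumax].
exists (Menu (stop_loss tau) (dstar X H thetas tau)); split => //; last first.
  move=> t /TsubE t1; split => //.
  exact: (premium_dstar H_cost dom_stop_loss thetasP).
have iPhi : Q.-integrable T (EFin \o Phi X H thetas tau).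
  apply: (integrable_le_gtNy T_measurable _ ig).
  - by apply/measurable_EFinP; exact: mPhi.
  - by move=> t Tt_; rewrite lee_fin Phig.
  by apply: lt_le_trans (taumax +oo%E _) => //; rewrite J0.
have iPhiTS : Q.-integrable (@type_space R K) (EFin \o Phi X H thetas tau).
  apply/(negligible_integrable mN) => //; last by rewrite TN.
  by apply/measurable_EFinP; exact: mPhiTS.
split; first by split => //; exact: (feasible_dstar H_cost dom_stop_loss thetasP).
move=> M' [M'f iM'].
have [tau' t'0 M'le] := menu_profit_le_Phi H_cost dom_stop_loss thetasP M'f.
rewrite (negligible_integral mN mTS iM' QN) (negligible_integral mN mTS iPhiTS QN) TN.
apply: le_trans (taumax tau' t'0).
have iM'T : Q.-integrable T (EFin \o menu_profit X H M').
  exact: integrableS iM'.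
apply: le_integral => //; last by move=> t /set_mem /TsubE t1; rewrite lee_fin M'le.
(* [Phi] at [tau'] is squeezed between the profit of [M'] and the envelope, both integrable. *)
apply: (@le_integrable _ _ _ Q T T_measurable _
  (fun t => `|(menu_profit X H M' t)%:E| + `|(g t)%:E|)%E).
- by apply/measurable_EFinP; exact: mPhi.
- move=> t Tt_; rewrite /= lee_fin [leRHS]ger0_norm; last by rewrite addr_ge0.
  have := M'le t (TsubE _ Tt_); have := Phig _ _ t'0 Tt_.
  have := normr_ge0 (g t); have := normr_ge0 (menu_profit X H M' t).
  have := ler_norm (g t); have := ler_norm (- menu_profit X H M' t); rewrite normrN.
  by rewrite ler_norml => *; apply/andP; split; lra.
by apply: integrableD => //; exact: integrable_abse.
Qed.
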